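(* Let $n_x\ge 1$ and $A,A_{d_1},A_{d_2}\in\mathbf{R}^{n_x\times n_x}$ be given, and for integers $M\ge 1$, $0\le m\le M-1$ and a real $\tau>0$ let $\mathcal{L}_{M,m}(\tau)$ be the system of linear matrix inequalities defined in the context, obtained with the parameter choice $m_1=m$, $m_2=m+1$, $\nu_{1,j}=M-j-1$, $\nu_{2,j}=\nu_{1,j}+1$ $(j=0,1,\ldots,m)$. Write $\mathcal{L}_{M,m}\prec\mathcal{L}_{\hat{M},\hat{m}}$ if for every $\tau>0$ for which $\mathcal{L}_{M,m}(\tau)$ has a feasible solution, $\mathcal{L}_{\hat{M},\hat{m}}(\tau)$ has a feasible solution, too. Then $$\mathcal{L}_{M,m}\prec\mathcal{L}_{M+1,m},$$ and $$\mathcal{L}_{M,m}\prec\mathcal{L}_{M,m+1}$$ (the latter for those $M,m$ for which $(M,m+1)$ is also admissible, i.e. $m+1\le M-1$).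
   Context: $\mathbf{S}_n$ and $\mathbf{S}_n^+$ are the sets of symmetric, respectively symmetric positive definite, real $n\times n$ matrices; $>0$ and $<0$ for symmetric matrices mean positive and negative definite; $\otimes$ is the Kronecker product; $I=I_{n_x}$; $0$ denotes zero blocks of compatible size; $\mathrm{diag}$ denotes (block) diagonal matrices. The inequalities are stability conditions for the system $\dot{x}(t)=Ax(t)+A_{d_1}x(t-\tau)+A_{d_2}\int_{t-\tau}^tx(s)\,ds$. Fix $M,m$ and put $m_1=m$, $m_2=m+1$, $\nu_{1,j}=M-j-1$, $\nu_{2,j}=M-j$ for $j=0,\ldots,m$. Polynomials. For integers $k,n\ge 0$ let $P_{k,0}(x)\equiv 1$ and $P_{k,n}(x)=\frac{1}{n!}\frac{1}{x^k}\frac{d^n}{dx^n}\left(x^k(x^2-x)^n\right)$, $n\ge 1$. Let $q_{k,k+i}(x)=x^kP_{k,i}(x)$ (degree $k+i$). If $k+i\le M-1$, define $\xi^k_{i,l}$ by $q_{k,k+i}(x)=\sum_{l=0}^{M-1}\xi^k_{i,l}P_{0,l}(x)$. If $k+i\le M$, define $\zeta^k_{i,l}$ by $q'_{k,k+i}(x)=\sum_{l=0}^{M-1}\zeta^k_{i,l}P_{0,l}(x)$ (derivative in $x$). Put $$\underline{\xi}^k_i=(\xi^k_{i,0},\ldots,\xi^k_{i,M-1}),\quad \underline{\zeta}^0_i=(1,(-1)^{i+1},-\zeta^0_{i,0},\ldots,-\zeta^0_{i,M-1}),\quad \underline{\zeta}^k_i=(1,0,-\zeta^k_{i,0},\ldots,-\zeta^k_{i,M-1})\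 (k>0).$$ $\Xi_k\in\mathbf{R}^{(\nu_{1,k}+1)\times M}$ has rows $\underline{\xi}^k_0,\ldots,\underline{\xi}^k_{\nu_{1,k}}$; $\mathcal{Z}_k\in\mathbf{R}^{(\nu_{2,k}+1)\times(M+2)}$ has rows $\underline{\zeta}^k_0,\ldots,\underline{\zeta}^k_{\nu_{2,k}}$; $\widetilde{\mathcal{L}}_0\in\mathbf{R}^{M\times(M+2)}$ has rows $\underline{\zeta}^0_0,\ldots,\underline{\zeta}^0_{M-1}$. Further matrices: $$\mathcal{Q}^{(k)}_j=\mathrm{diag}\{(j+1)Q_k,(j+3)Q_k,\ldots,(j+2\nu_{1,j}+1)Q_k\},\qquad \mathcal{R}^{(j)}_{j-1}=\mathrm{diag}\{jR_j,(j+2)R_j,\ldots,(j+2\nu_{2,j-1})R_j\},$$ $$\mathcal{A}=(A,\ A_{d_1},\ \tau A_{d_2},\ 0,\ldots,0)\in\mathbf{R}^{n_x\times n_x(M+2)},\qquad \Lambda_M=\begin{bmatrix}\mathcal{A}\\ \widetilde{\mathcal{L}}_0\otimes I\end{bmatrix},\qquad \Gamma_M=\begin{bmatrix}1&0&0\\0&0&\tau I_M\end{bmatrix}\otimes I ,$$ $$\Psi^0_{M,m_1}(\tau)=\tau P+\sum_{j=0}^{m_1}\mathrm{diag}\left\{0,\ (\Xi_j\otimes I)^T\mathcal{Q}^{(j)}_j(\Xi_j\otimes I)\right\}\quad(\text{the leading }0\text{ is }n_x\times n_x),$$ $$\Psi^1_M(\tau)=\Gamma_M^TP\Lambda_M+\Lambda_M^TP\Gamma_M,$$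 $$\Psi^2_{M,m_1}=\mathrm{diag}\left\{\sum_{j=0}^{m_1}Q_j,\ -Q_0,\ -\sum_{j=1}^{m_1}j\,(\Xi_{j-1}\otimes I)^T\mathcal{Q}^{(j)}_{j-1}(\Xi_{j-1}\otimes I)\right\},$$ $$\Psi^{3,1}_{M,m_2}(\tau)=\tau\mathcal{A}^T\left(\sum_{j=1}^{m_2}R_j\right)\mathcal{A},\qquad \Psi^{3,2}_{M,m_2}(\tau)=\frac{1}{\tau}\sum_{j=1}^{m_2}j\,(\mathcal{Z}_{j-1}\otimes I)^T\mathcal{R}^{(j)}_{j-1}(\mathcal{Z}_{j-1}\otimes I).$$ $\mathcal{L}_{M,m}(\tau)$ denotes the pair of linear matrix inequalities $$\Psi^0_{M,m_1}(\tau)>0,\qquad \Psi^1_M(\tau)+\Psi^2_{M,m_1}+\Psi^{3,1}_{M,m_2}(\tau)-\Psi^{3,2}_{M,m_2}(\tau)<0$$ in the unknowns $P\in\mathbf{S}_{n_x(M+1)}$, $Q_j\in\mathbf{S}^+_{n_x}$ $(j=0,\ldots,m_1)$, $R_j\in\mathbf{S}^+_{n_x}$ $(j=1,\ldots,m_2)$; a feasible solution is a choice of these matrices satisfying both inequalities. *)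

(* Defs.v *)
From HB Require Import structures.
From mathcomp Require Import all_boot all_order all_algebra.
From mathcomp Require Import boolp classical_sets reals.
From mathcomp Require Import mxtens.

Set Implicit Arguments.
Unset Strict Implicit.
Unset Printing Implicit Defensive.

Import Order.TTheory GRing.Theory Num.Theory.
Local Open Scope ring_scope.

Section DefiniteMatrices.
Variable R : realType.

Definition posdefmx n (X : 'M[R]_n) : Prop :=
  X \is symmetricmx /\ forall v : 'cV[R]_n, v != 0 -> 0 < (v^T *m X *m v) 0 0.

Definition negdefmx n (X : 'M[R]_n) : Prop :=
  X \is symmetricmx /\ forall v : 'cV[R]_n, v != 0 -> (v^T *m X *m v) 0 0 < 0.

End DefiniteMatrices.

Section Polynomials.
Variable R : realType.

Definition rodrigues k n : {poly R} := ('X^k * ('X^2 - 'X) ^+ n)^`(n).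

(* jacobi k n is P_{k,n}; the quotient by 'X^k is exact, see rodrigues_dvd. *)
Definition jacobi k n : {poly R} :=
  if n is 0 then 1 else (n`!%:R)^-1 *: (rodrigues k n %/ 'X^k).

(* qpoly k i is q_{k,k+i}. *)
Definition qpoly k i : {poly R} := 'X^k * jacobi k i.

(* The unique coefficient vector of p on P_{0,0}, ..., P_{0,M-1}; it exists
   exactly when p has degree < M. *)
Definition legendre_coords M (p : {poly R}) : 'rV[R]_M :=
  xget 0 [set c : 'rV[R]_M | p = \sum_(l < M) c 0 l *: jacobi 0 l]%classic.

Lemma rodrigues_dvd k n : 'X^k %| rodrigues k n.
Proof.
have dvdD a (p : {poly R}) : 'X^(a.+1) %| p -> 'X^a %| p^`().
  case/dvdpP=> u ->; rewrite derivM derivXn /= dvdp_add //.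
    by rewrite exprS mulrA dvdp_mull.
  by rewrite mulrnAr -mulrnAl dvdp_mull.
have dvdDn b a (p : {poly R}) : 'X^(a + b) %| p -> 'X^a %| p^`(b).
  elim: b a p => [|b IH] a p; first by rewrite addn0 derivn0.
  by rewrite addnS -addSn derivnS => /IH/dvdD.
apply: dvdDn; rewrite exprD dvdp_mul2l ?monic_neq0 ?monicXn //.
have -> : 'X^2 - 'X = 'X * ('X - 1) :> {poly R}.
  by rewrite mulrBr mulr1 expr2.
by rewrite exprMn dvdp_mulr.
Qed.

Lemma jacobiE k n : 'X^k * jacobi k n = (n`!%:R)^-1 *: rodrigues k n.
Proof.
case: n => [|n]; first by rewrite /rodrigues derivn0 expr0 !mulr1 invr1 scale1r.
by rewrite /jacobi -scalerAr mulrC divpK // rodrigues_dvd.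
Qed.

Lemma size_rodrigues k n : size (rodrigues k n) = (k + n).+1.
Proof.
have szX : size ('X^2 - 'X : {poly R}) = 3.
  by rewrite size_polyDl ?size_polyXn // size_polyN size_polyX.
have X_neq0 : ('X^2 - 'X : {poly R}) != 0 by rewrite -size_poly_gt0 szX.
rewrite /rodrigues; set p := 'X^k * _.
have szp : size p = (k + n + n).+1.
  rewrite size_monicM ?monicXn ?expf_neq0 // size_polyXn /=.
  have := size_exp ('X^2 - 'X : {poly R}) n; rewrite szX /=.
  case: (size _) (size_poly_gt0 (('X^2 - 'X : {poly R}) ^+ n)) => [|s _ /= ->].
    by rewrite expf_neq0.
  by rewrite addnS mul2n -addnn addnA.
apply/eqP; rewrite eqn_leq; apply/andP; split.
  apply/leq_sizeP => j lej; rewrite coef_derivn nth_default ?mul0rn //.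
  by rewrite szp -addSn addnC leq_add2l.
apply: contraT; rewrite -leqNgt => /leq_sizeP/(_ _ (leqnn _))/eqP.
rewrite coef_derivn mulrn_eq0 [(n + _)%N]addnC eqn0Ngt ffact_gt0 leq_addl /=.
have : lead_coef p != 0 by rewrite lead_coef_eq0 -size_poly_gt0 szp.
by rewrite /lead_coef szp /= => /negPf ->.
Qed.

Lemma size_qpoly k i : size (qpoly k i) = (k + i).+1.
Proof.
by rewrite /qpoly jacobiE size_scale ?size_rodrigues // invr_eq0 pnatr_eq0
           -lt0n fact_gt0.
Qed.

Lemma size_jacobi0 l : size (jacobi 0 l) = l.+1.
Proof. by rewrite -[jacobi 0 l]mul1r -(size_qpoly 0). Qed.

Lemma legendre_span M (p : {poly R}) :
  (size p <= M)%N -> exists c : 'rV[R]_M, p = \sum_(l < M) c 0 l *: jacobi 0 l.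
Proof.
elim: M p => [|M IH] p.
  by rewrite leqn0 size_poly_eq0 => /eqP->; exists 0; rewrite big_ord0.
move=> szp; set a := p`_M / (jacobi 0 M)`_M.
have nz : (jacobi 0 M)`_M != 0.
  have := lead_coef_eq0 (jacobi 0 M).
  by rewrite /lead_coef -size_poly_eq0 size_jacobi0 /= => ->.
have [|c Ec] := IH (p - a *: jacobi 0 M).
  apply/leq_sizeP => j; rewrite leq_eqVlt => /predU1P[<-|ltj].
    by rewrite coefB coefZ divfK ?subrr.
  by rewrite coefB coefZ !nth_default ?mulr0 ?subr0 ?size_jacobi0 // (leq_trans szp).
exists (\row_l if unlift ord_max l is Some l' then c 0 l' else a).
rewrite big_ord_recr /= mxE unlift_none -[LHS](subrK (a *: jacobi 0 M)) Ec.
congr (_ + _); apply: eq_bigr => l _; rewrite mxE.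
have -> : widen_ord (leqnSn M) l = lift ord_max l.
  by apply/val_inj; rewrite /= /bump leqNgt ltn_ord.
by rewrite liftK.
Qed.

Lemma legendre_free M (c : 'rV[R]_M) :
  \sum_(l < M) c 0 l *: jacobi 0 l = 0 -> c = 0.
Proof.
elim: M c => [|M IH] c; first by rewrite thinmx0.
rewrite big_ord_recr /= => E.
have cM : c 0 ord_max = 0.
  have /eqP := congr1 (fun p : {poly R} => p`_M) E.
  rewrite coefD coef_sum big1 ?add0r => [|l _]; last first.
    by rewrite coefZ nth_default ?mulr0 // size_jacobi0.
  rewrite coefZ coef0 mulf_eq0 => /orP[/eqP //|].
  have := lead_coef_eq0 (jacobi 0 M).
  by rewrite /lead_coef -size_poly_eq0 size_jacobi0 /= => ->.
have /IH c0 : \sum_(l < M)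
    (\row_l c 0 (widen_ord (leqnSn M) l)) 0 l *: jacobi 0 l = 0.
  rewrite cM scale0r addr0 in E; rewrite -[RHS]E.
  by apply: eq_bigr => l _; rewrite mxE.
apply/rowP => l; rewrite mxE; have [ltl|] := ltnP l M.
  have /rowP/(_ (Ordinal ltl)) := c0; rewrite !mxE => <-.
  by congr (c 0 _); apply: val_inj.
move=> leM; rewrite -cM; congr (c 0 _); apply: val_inj => /=.
by apply/eqP; rewrite eqn_leq leM -ltnS ltn_ord.
Qed.

Lemma legendre_coordsP M (p : {poly R}) : (size p <= M)%N ->
  p = \sum_(l < M) legendre_coords M p 0 l *: jacobi 0 l.
Proof. by move/legendre_span/(xgetPex 0). Qed.

Lemma legendre_coords_unique M (p : {poly R}) (c : 'rV[R]_M) :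
  p = \sum_(l < M) c 0 l *: jacobi 0 l -> legendre_coords M p = c.
Proof.
move=> Ep; apply: xget_unique => //= d Ed; apply/eqP; rewrite -subr_eq0.
apply/eqP/legendre_free; rewrite -[RHS](subrr p) {1}Ed Ep -sumrB.
by apply: eq_bigr => l _; rewrite !mxE scalerBl.
Qed.

End Polynomials.

Section LMI.
Variable R : realType.

Definition nu1 (M j : nat) : nat := (M - j - 1)%N.
Definition nu2 (M j : nat) : nat := (M - j)%N.

Definition xi_row M k i : 'rV[R]_M := legendre_coords M (qpoly R k i).

Definition zeta_row M k i : 'rV[R]_(1 + (1 + M)) :=
  row_mx 1%:M
    (row_mx (if k == 0%N then (-1) ^+ i.+1 else 0)%:M
            (- legendre_coords M (qpoly R k i)^`())).

Definition Ximx M k : 'M[R]_((nu1 M k).+1, M) := \matrix_(i < _) xi_row M k i.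

Definition Zmx M k : 'M[R]_((nu2 M k).+1, M.+2) :=
  \matrix_(i < _) zeta_row M k i.

Definition L0mx M : 'M[R]_(M, M.+2) := \matrix_(i < M) zeta_row M 0 i.

Variable nx : nat.

(* The block row (B_0, ..., B_{p-1}), with the indexing of blocks used by the
   Kronecker product *t. *)
Definition blockrow p (B : 'I_p -> 'M[R]_nx) : 'M[R]_(nx, p * nx) :=
  \matrix_(i, j) B (mxtens_unindex j).1 i (mxtens_unindex j).2.

(* Block diagonal matrices diag{c_0 X, ..., c_{p-1} X} are written
   diag(c_0, ..., c_{p-1}) *t X; calQ M j Q_k and calR M j R_j are the
   matrices Q^{(k)}_j and R^{(j)}_{j-1}. *)
Definition calQ M j (X : 'M[R]_nx) :
    'M[R]_((nu1 M j).+1 * nx, (nu1 M j).+1 * nx) :=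
  diag_mx (\row_(i < (nu1 M j).+1) (j + 2 * i + 1)%:R) *t X.

Definition calR M j (X : 'M[R]_nx) :
    'M[R]_((nu2 M j.-1).+1 * nx, (nu2 M j.-1).+1 * nx) :=
  diag_mx (\row_(i < (nu2 M j.-1).+1) (j + 2 * i)%:R) *t X.

Definition kronI p q (X : 'M[R]_(p, q)) : 'M[R]_(p * nx, q * nx) :=
  X *t (1%:M : 'M[R]_nx).

Variables A Ad1 Ad2 : 'M[R]_nx.
Variables M m1 m2 : nat.
Variable tau : R.
Variable P : 'M[R]_(M.+1 * nx).
Variables Q Rm : nat -> 'M[R]_nx.

Definition calA : 'M[R]_(nx, M.+2 * nx) :=
  blockrow (fun l : 'I_M.+2 => nth 0 [:: A; Ad1; tau *: Ad2] l).

(* p.+1 * nx is convertible to nx + p * nx, so block constructors apply to the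
   dimensions M.+1 * nx and M.+2 * nx without casts. *)
Definition Lambda : 'M[R]_(M.+1 * nx, M.+2 * nx) :=
  (col_mx calA (kronI (L0mx M)) : 'M[R]_(nx + M * nx, M.+2 * nx)).

Definition Gamma : 'M[R]_(M.+1 * nx, M.+2 * nx) :=
  kronI (block_mx 1%:M (row_mx 0 0) 0 (row_mx 0 tau%:M) :
           'M[R]_(1 + M, 1 + (1 + M))).

Definition Psi0 : 'M[R]_(M.+1 * nx) :=
  tau *: P +
  \sum_(0 <= j < m1.+1)
    (block_mx 0 0 0 ((kronI (Ximx M j))^T *m calQ M j (Q j) *m kronI (Ximx M j))
       : 'M[R]_(nx + M * nx)).

Definition Psi1 : 'M[R]_(M.+2 * nx) :=
  Gamma^T *m P *m Lambda + Lambda^T *m P *m Gamma.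

Definition Psi2 : 'M[R]_(M.+2 * nx) :=
  (block_mx (\sum_(0 <= j < m1.+1) Q j) 0 0
     (block_mx (- Q 0%N) 0 0
        (- \sum_(1 <= j < m1.+1)
             j%:R *: ((kronI (Ximx M j.-1))^T *m calQ M j.-1 (Q j) *m
                        kronI (Ximx M j.-1))))
     : 'M[R]_(nx + (nx + M * nx))).

Definition Psi31 : 'M[R]_(M.+2 * nx) :=
  tau *: (calA^T *m (\sum_(1 <= j < m2.+1) Rm j) *m calA).

Definition Psi32 : 'M[R]_(M.+2 * nx) :=
  tau^-1 *: \sum_(1 <= j < m2.+1)
    j%:R *: ((kronI (Zmx M j.-1))^T *m calR M j (Rm j) *m kronI (Zmx M j.-1)).

End LMI.

(* Only Q 0, ..., Q m and Rm 1, ..., Rm m.+1 are constrained and used. *)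
Definition LMI_solution (R : realType) nx (A Ad1 Ad2 : 'M[R]_nx) (M m : nat)
    (tau : R) (P : 'M[R]_(M.+1 * nx)) (Q Rm : nat -> 'M[R]_nx) : Prop :=
  [/\ P \is symmetricmx,
      forall j, (j <= m)%N -> posdefmx (Q j),
      forall j, (1 <= j <= m.+1)%N -> posdefmx (Rm j),
      posdefmx (Psi0 m tau P Q) &
      negdefmx (Psi1 A Ad1 Ad2 tau P + Psi2 M m Q
                + Psi31 A Ad1 Ad2 M m.+1 tau Rm - Psi32 M m.+1 tau Rm)].

Definition LMI_feasible (R : realType) nx (A Ad1 Ad2 : 'M[R]_nx) (M m : nat)
    (tau : R) : Prop :=
  exists (P : 'M[R]_(M.+1 * nx)) (Q Rm : nat -> 'M[R]_nx),
    LMI_solution A Ad1 Ad2 m tau P Q Rm.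

Definition LMI_prec (R : realType) nx (A Ad1 Ad2 : 'M[R]_nx)
    (M m Mhat mhat : nat) : Prop :=
  forall tau : R, 0 < tau ->
    LMI_feasible A Ad1 Ad2 M m tau -> LMI_feasible A Ad1 Ad2 Mhat mhat tau.

(* Main.v *)
(* Every matrix of the LMI system is a combination of congruences B^T X B with X
   one of P, Q_j, R_j, and B built from rows of coefficients; let Psi be the
   matrix of the second inequality.

   From M to M+1, keep Q_j, R_j and replace P by F^T P F, where F drops the last
   block. Rows of Xi_j and Z_j that already occur for M just get a zero appended,
   so Psi0 becomes F^T Psi0 F + Y0 and Psi becomes T^T Psi T - Y, where T drops
   the last block and Y0, Y are positive semidefinite and come from the
   additional rows. On the kernels of F and T, Y0 and Y are positive, since
   q_{0,M} and q'_{0,M+1} have degree exactly M, so that their last Legendre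
   coordinate does not vanish.

   From m to m+1, keep all matrices and let the new Q and R be eps I. Up to
   terms with the favourable sign this adds eps G to Psi, where G is fixed and
   positive semidefinite; a negative definite Psi absorbs it for small eps. *)
Require Import Defs.
From mathcomp Require Import all_boot all_order all_algebra.
From mathcomp Require Import reals mxtens polyorder.
From mathcomp Require Import ring lra zify.

Set Implicit Arguments.
Unset Strict Implicit.
Unset Printing Implicit Defensive.

Import Order.TTheory GRing.Theory Num.Theory.
Local Open Scope ring_scope.

(** * Congruences, semidefiniteness and a Cauchy-Schwarz bound *)

Section QuadraticForms.
Variable R : realType.

Definition congmx p q (B : 'M[R]_(p, q)) (X : 'M[R]_p) : 'M[R]_q :=
  B^T *m X *m B.

Definition qform n (X : 'M[R]_n) (v : 'cV[R]_n) : R := (v^T *m X *m v) 0 0.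

Lemma symmetricmxP n (X : 'M[R]_n) : X \is symmetricmx <-> X^T = X.
Proof.
rewrite qualifE /= expr0 scale1r.
have -> : map_mx idfun X^T = X^T by apply/matrixP => i j; rewrite !mxE.
by split=> [/eqP/esym|->].
Qed.

Lemma trmx_congmx p q (B : 'M[R]_(p, q)) (X : 'M[R]_p) :
  X^T = X -> (congmx B X)^T = congmx B X.
Proof. by move=> EX; rewrite /congmx !trmx_mul trmxK EX mulmxA. Qed.

Lemma congmxM p q r (B : 'M[R]_(p, q)) (C : 'M[R]_(q, r)) (X : 'M[R]_p) :
  congmx (B *m C) X = congmx C (congmx B X).
Proof. by rewrite /congmx trmx_mul !mulmxA. Qed.

Lemma congmxD p q (B : 'M[R]_(p, q)) (X Y : 'M[R]_p) :
  congmx B (X + Y) = congmx B X + congmx B Y.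
Proof. by rewrite /congmx mulmxDr mulmxDl. Qed.

Lemma congmxN p q (B : 'M[R]_(p, q)) (X : 'M[R]_p) :
  congmx B (- X) = - congmx B X.
Proof. by rewrite /congmx mulmxN mulNmx. Qed.

Lemma congmxZ p q (B : 'M[R]_(p, q)) (a : R) (X : 'M[R]_p) :
  congmx B (a *: X) = a *: congmx B X.
Proof. by rewrite /congmx -scalemxAr -scalemxAl. Qed.

Lemma congmx_sum p q (B : 'M[R]_(p, q)) I (r : seq I) (P : pred I)
    (F : I -> 'M[R]_p) :
  congmx B (\sum_(i <- r | P i) F i) = \sum_(i <- r | P i) congmx B (F i).
Proof. by rewrite /congmx mulmx_sumr mulmx_suml. Qed.

Lemma qform_congmx p q (B : 'M[R]_(p, q)) (X : 'M[R]_p) v :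
  qform (congmx B X) v = qform X (B *m v).
Proof. by rewrite /qform /congmx trmx_mul !mulmxA. Qed.

Lemma qformD n (X Y : 'M[R]_n) v : qform (X + Y) v = qform X v + qform Y v.
Proof. by rewrite /qform mulmxDr mulmxDl mxE. Qed.

Lemma qformN n (X : 'M[R]_n) v : qform (- X) v = - qform X v.
Proof. by rewrite /qform mulmxN mulNmx mxE. Qed.

Lemma qformZ n a (X : 'M[R]_n) v : qform (a *: X) v = a * qform X v.
Proof. by rewrite /qform -scalemxAr -scalemxAl mxE. Qed.

Definition psdmx n (X : 'M[R]_n) : Prop :=
  X^T = X /\ forall v : 'cV[R]_n, 0 <= qform X v.

Lemma psdmx0 n : psdmx (0 : 'M[R]_n).
Proof. by split=> [|v]; rewrite ?trmx0 // /qform mulmx0 mul0mx mxE. Qed.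

Lemma psdmxD n (X Y : 'M[R]_n) : psdmx X -> psdmx Y -> psdmx (X + Y).
Proof.
case=> sX pX [sY pY]; split=> [|v]; first by rewrite linearD /= sX sY.
by rewrite qformD addr_ge0.
Qed.

Lemma psdmxZ n (a : R) (X : 'M[R]_n) : 0 <= a -> psdmx X -> psdmx (a *: X).
Proof.
move=> a_ge0 [sX pX]; split=> [|v]; first by rewrite linearZ /= sX.
by rewrite qformZ mulr_ge0.
Qed.

Lemma psdmx_sum n (I : eqType) (r : seq I) (F : I -> 'M[R]_n) :
  (forall i, i \in r -> psdmx (F i)) -> psdmx (\sum_(i <- r) F i).
Proof.
move=> pF; rewrite big_seq; apply: (big_ind (@psdmx n)) => //.
  exact: psdmx0.
exact: psdmxD.
Qed.

Lemma posdefmx_psd n (X : 'M[R]_n) : posdefmx X -> psdmx X.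
Proof.
case=> /symmetricmxP sX pX; split=> // v.
have [->|/pX/ltW //] := eqVneq v 0.
by rewrite /qform mulmx0 mxE.
Qed.

Lemma psdmx_congmx p q (B : 'M[R]_(p, q)) (X : 'M[R]_p) :
  psdmx X -> psdmx (congmx B X).
Proof.
case=> sX pX; split=> [|v]; first exact: trmx_congmx.
by rewrite qform_congmx.
Qed.

Lemma negdefmxN n (X : 'M[R]_n) : negdefmx X <-> posdefmx (- X).
Proof.
have E (v : 'cV_n) : (v^T *m (- X) *m v) 0 0 = - (v^T *m X *m v) 0 0
  by apply: qformN.
split=> -[/symmetricmxP sX pX]; split=> [|v /pX].
- by apply/symmetricmxP; rewrite linearN /= sX.
- by rewrite E oppr_gt0.
- by apply/symmetricmxP; rewrite -[RHS]opprK -sX linearN /= opprK.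
- by rewrite E oppr_gt0.
Qed.

Lemma posdefmxD n (X Y : 'M[R]_n) : posdefmx X -> psdmx Y -> posdefmx (X + Y).
Proof.
case=> /symmetricmxP sX pX [sY pY]; split=> [|v v0].
  by apply/symmetricmxP; rewrite linearD /= sX sY.
by rewrite -/(qform _ _) qformD ltr_wpDr ?pY ?pX.
Qed.

(** A vector outside the kernel of [T] gets a positive value from the congruence and a nonnegative
    one from [Y]. On the kernel the congruence vanishes and [Y] alone gives positivity. *)
Lemma posdefmx_congD p q (N : 'M[R]_p) (T : 'M[R]_(p, q)) (Y : 'M[R]_q) :
  posdefmx N -> psdmx Y ->
  (forall v : 'cV[R]_q, T *m v = 0 -> v != 0 -> 0 < qform Y v) ->
  posdefmx (congmx T N + Y).
Proof.
case=> /symmetricmxP sN pN [sY pY] kerT; split=> [|v v0].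
  by apply/symmetricmxP; rewrite linearD /= trmx_congmx ?sY.
rewrite -/(qform _ _) qformD qform_congmx.
have [Tv0|Tv0] := eqVneq (T *m v) 0.
  by rewrite Tv0 /qform mulmx0 mxE add0r kerT.
by rewrite ltr_wpDr ?pY ?pN.
Qed.

Lemma posdefmx_unit n (S : 'M[R]_n) : posdefmx S -> S \in unitmx.
Proof.
case=> _ pS; rewrite unitmxE unitfE; apply/negP => /det0P[z z0 zS].
have /pS : z^T != 0 by rewrite trmx_eq0.
by rewrite trmxK zS mul0mx mxE ltxx.
Qed.

(** Cauchy-Schwarz for the inner product given by [S]. With [a] the value of the form at [z] and [b]
    the product of [z] and [v], the form at [a *: v - b *: z] equals [a * (a * qform S v - b ^+ 2)];
    it is nonnegative, and [a] can be cancelled when [z] is nonzero. *)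
Lemma posdefmx_cauchy n (S : 'M[R]_n) (z v : 'cV[R]_n) : posdefmx S ->
  (z^T *m S *m v) 0 0 ^+ 2 <= qform S z * qform S v.
Proof.
move=> pdS; have [sS pS] := posdefmx_psd pdS.
set a := qform S z; set b := (_ *m v) 0 0.
have [z0|z0] := eqVneq z 0.
  by rewrite /b /a z0 trmx0 !mul0mx mxE expr0n /qform mulmx0 mxE mul0r.
have a0 : 0 < a by case: pdS => _; exact.
have b' : (v^T *m S *m z) 0 0 = b.
  rewrite -[LHS]/((_ *m _) 0 0) -[_ *m z]trmxK mxE.
  by rewrite !trmx_mul trmxK sS mulmxA.
have := pS (a *: v - b *: z).
have trE : (a *: v - b *: z)^T = a *: v^T - b *: z^T.
  by apply/matrixP => i j; rewrite !mxE.
rewrite /qform trE.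
rewrite !(mulmxBl, mulmxBr) -!(scalemxAl, scalemxAr).
have mxA (X Y : 'M[R]_1) : (X + Y) 0 0 = X 0 0 + Y 0 0 by rewrite mxE.
have mxN (X : 'M[R]_1) : (- X) 0 0 = - X 0 0 by rewrite mxE.
have mxZ c (X : 'M[R]_1) : (c *: X) 0 0 = c * X 0 0 by rewrite mxE.
rewrite !(mxA, mxN, mxZ) b' -/b -/(qform S v) -/(qform S z) -/a => H.
rewrite -subr_ge0 -(pmulr_rge0 _ a0); apply: le_trans H _.
by rewrite le_eqVlt; apply/orP; left; apply/eqP; ring.
Qed.

(** Each entry of [B *m v] is the [S]-inner product of [v] with the vector [z i] that represents row
    [i] of [B], so Cauchy-Schwarz bounds its square. This compactness-free bound supplies the
    constants that determine how small the new blocks must be when m grows. *)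
Lemma posdefmx_dominates p n (S : 'M[R]_n) (B : 'M[R]_(p, n)) : posdefmx S ->
  exists2 c : R, 0 <= c & forall v, qform (B^T *m B) v <= c * qform S v.
Proof.
move=> pdS; have pS := posdefmx_psd pdS; have uS := posdefmx_unit pdS.
pose z i := invmx S *m (row i B)^T.
exists (\sum_i qform S (z i)) => [|v].
  by apply: sumr_ge0 => i _; case: pS.
have -> : qform (B^T *m B) v = \sum_i (B *m v) i 0 ^+ 2.
  rewrite /qform mulmxA -mulmxA -trmx_mul mxE.
  by apply: eq_bigr => i _; rewrite mxE expr2.
rewrite mulr_suml; apply: ler_sum => i _.
suff -> : (B *m v) i 0 = ((z i)^T *m S *m v) 0 0 by apply: posdefmx_cauchy.
have -> : (z i)^T *m S = row i B.
  by rewrite -[S in LHS](proj1 pS) -trmx_mul mulmxA mulmxV // mul1mx trmxK.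
by rewrite -row_mul [RHS]mxE.
Qed.

End QuadraticForms.

(** * Kronecker products with the identity, seen as block rows *)

Section BlockRows.
Variables (R : realType) (nx : nat).

(** This is the Kronecker product of a row with the identity. Written as a block row it has [nx]
    rows instead of [1 * nx], so it can act on an [nx] by [nx] matrix by congruence. *)
Definition kronrow p (c : 'rV[R]_p) : 'M[R]_(nx, p * nx) :=
  blockrow (fun l => (c 0 l)%:M).

Lemma eq_blockrow p (B C : 'I_p -> 'M[R]_nx) :
  B =1 C -> blockrow B = blockrow C.
Proof. by move=> eqBC; apply/matrixP => i j; rewrite !mxE eqBC. Qed.

Lemma sum_mxtens p q (F : 'I_(p * q) -> R) :
  \sum_i F i = \sum_k \sum_l F (mxtens_index (k, l)).
Proof.
rewrite (reindex (@mxtens_index p q)) /=; last first.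
  by exists (@mxtens_unindex p q) => k _;
    rewrite (mxtens_indexK, mxtens_unindexK).
by rewrite pair_bigA /=; apply: eq_bigr => -[].
Qed.

Lemma kronI_mul p q r (X : 'M[R]_(p, q)) (Y : 'M[R]_(q, r)) :
  kronI nx X *m kronI nx Y = kronI nx (X *m Y).
Proof. by rewrite /kronI tensmx_mul mulmx1. Qed.

Lemma mul_blockrow_kronI p q (B : 'I_p -> 'M[R]_nx) (X : 'M[R]_(p, q)) :
  blockrow B *m kronI nx X = blockrow (fun l => \sum_k X k l *: B k).
Proof.
apply/matrixP => i j; case: (mxtens_indexP j) => l s.
rewrite !mxE mxtens_indexK /= summxE sum_mxtens.
apply: eq_bigr => k _; rewrite (bigD1 s) //= big1 => [|t ts].
  by rewrite /kronI tensmxE !mxE mxtens_indexK /= eqxx mulr1 addr0 mulrC.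
by rewrite /kronI tensmxE !mxE (negPf ts) !mulr0.
Qed.

Lemma kronrowM p q (c : 'rV[R]_p) (X : 'M[R]_(p, q)) :
  kronrow (c *m X) = kronrow c *m kronI nx X.
Proof.
rewrite /kronrow mul_blockrow_kronI; apply: eq_blockrow => l.
by rewrite mxE raddf_sum; apply: eq_bigr => k _; rewrite scale_scalar_mx mulrC.
Qed.

Lemma congmx_kronrow p (c : 'rV[R]_p) (X : 'M[R]_nx) :
  congmx (kronrow c) X = (c^T *m c) *t X.
Proof.
have EX : X *m kronrow c = blockrow (fun l => c 0 l *: X).
  apply/matrixP => i j; rewrite !mxE (bigD1 (mxtens_unindex j).2) //=.
  rewrite !mxE eqxx mulr1n mulrC big1 ?addr0 // => k kj.
  by rewrite !mxE (negPf kj) mulr0.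
rewrite /congmx -mulmxA EX; apply/matrixP => i j.
rewrite !mxE (bigD1 (mxtens_unindex i).2) //= !mxE eqxx mulr1n.
rewrite big1 ?addr0 => [|k ki]; last by rewrite !mxE (negPf ki) mul0r.
by rewrite big_ord1 !mxE mulrA.
Qed.

(** A diagonal weight does not mix the rows of [C], so the product splits into one congruence per
    row. This form lets the matrices for M and M+1 be compared row by row. *)
Lemma congmx_kronI_diag p q (C : 'M[R]_(p, q)) (d : 'rV[R]_p) (X : 'M[R]_nx) :
  (kronI nx C)^T *m (diag_mx d *t X) *m kronI nx C =
  \sum_(i < p) d 0 i *: congmx (kronrow (row i C)) X.
Proof.
rewrite /kronI trmx_tens trmx1 !tensmx_mul mul1mx mulmx1 mul_mx_diag.
apply/matrixP => k l; case: (mxtens_indexP k) => k' s.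
case: (mxtens_indexP l) => l' t.
rewrite tensmxE mxE summxE mulr_suml; apply: eq_bigr => i _.
by rewrite congmx_kronrow [RHS]mxE tensmxE !mxE big_ord1 !mxE; ring.
Qed.

(** With its companion for [rshift], this reconciles two indexings of [p.+1 * nx]: the pairs of
    block number and position used by [*t], and the sum [nx + p * nx] used by [row_mx] and
    [block_mx]. *)
Lemma mxtens_unindex_lshift p (s : 'I_nx) :
  mxtens_unindex (lshift (p * nx) s : 'I_(p.+1 * nx)) = (ord0, s).
Proof.
by congr (_, _); apply: val_inj; rewrite /= (divn_small, modn_small).
Qed.

Lemma mxtens_unindex_rshift p (k : 'I_(p * nx)) :
  mxtens_unindex (rshift nx k : 'I_(p.+1 * nx)) =
  (lift ord0 (mxtens_unindex k).1, (mxtens_unindex k).2).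
Proof.
(* Blocks of size zero are treated apart, since the quotient by [nx] below needs [nx] positive. *)
case: nx k => [|n] k; first by case: (mxtens_unindex k).2.
congr (_, _); apply: val_inj; rewrite /= ?modnDl //.
by rewrite divnDl // divnn.
Qed.

Lemma kronrow_row_mx p (a : R) (c : 'rV[R]_p) :
  kronrow (row_mx a%:M c : 'rV[R]_(1 + p)) =
  (row_mx a%:M (kronrow c) : 'M[R]_(nx, nx + p * nx)).
Proof.
have ord0E : ord0 = lshift p 0 :> 'I_(1 + p) by apply: val_inj.
have liftE l : lift ord0 l = rshift 1 l :> 'I_(1 + p) by apply: val_inj.
rewrite -[LHS]hsubmxK; congr row_mx; apply/matrixP => i j.
  rewrite [LHS]mxE [LHS]mxE mxtens_unindex_lshift /= ord0E.
  by rewrite row_mxEl [_%:M 0 0]mxE.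
rewrite [LHS]mxE [LHS]mxE mxtens_unindex_rshift /= liftE.
by rewrite row_mxEr [RHS]mxE.
Qed.

Lemma kronI_block_mx p q (X : 'M[R]_(p, q)) :
  kronI nx (block_mx 1%:M 0 0 X : 'M[R]_(1 + p, 1 + q)) =
  (block_mx 1%:M 0 0 (kronI nx X) : 'M[R]_(nx + p * nx, nx + q * nx)).
Proof.
have ord0E r : ord0 = lshift r 0 :> 'I_(1 + r) by apply: val_inj.
have liftE r l : lift ord0 l = rshift 1 l :> 'I_(1 + r) by apply: val_inj.
rewrite -[LHS]submxK; congr block_mx; apply/matrixP => i j;
  rewrite [LHS]mxE [LHS]mxE [LHS]mxE ?mxtens_unindex_lshift
    ?mxtens_unindex_rshift /= ?liftE ?ord0E.
- by rewrite block_mxEul [_%:M 0 0]mxE mul1r.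
- by rewrite block_mxEur !mxE mul0r.
- by rewrite block_mxEdl !mxE mul0r.
- by rewrite block_mxEdr [RHS]mxE.
Qed.

End BlockRows.

(** * The matrix that drops the last coordinate *)

Section Inclusion.
Variable R : realType.

(** This is the identity followed by a zero column. Acting on the left of a column it drops the last
    entry; acting on the right of a row it appends a zero. *)
Definition incl p : 'M[R]_(p, p.+1) := \matrix_(i, j) (i == j :> nat)%:R.

Lemma mul_incl_mx p q (X : 'M[R]_(p.+1, q)) :
  incl p *m X = \matrix_(i, j) X (widen_ord (leqnSn p) i) j.
Proof.
apply/matrixP => i j; rewrite !mxE (bigD1 (widen_ord (leqnSn p) i)) //=.
rewrite mxE eqxx mul1r big1 ?addr0 // => k ki.
by rewrite mxE eq_sym (negPf ki : (k == i :> nat) = false) mul0r.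
Qed.

Lemma mul_mx_incl p q (X : 'M[R]_(q, p)) i j :
  (X *m incl p) i j = if insub (val j) is Some l then X i l else 0.
Proof.
rewrite mxE; case: insubP => [l _ jl|]; last first.
  rewrite -leqNgt => lej; rewrite big1 // => k _; rewrite mxE.
  by rewrite ltn_eqF ?mulr0 // (leq_trans (ltn_ord k)).
rewrite (bigD1 l) //= big1 ?addr0 => [|k kl]; rewrite mxE -jl.
  by rewrite eqxx mulr1.
by rewrite val_eqE (negPf kl) mulr0.
Qed.

Lemma mul_mx_incl_widen p q (X : 'M[R]_(q, p)) i l :
  (X *m incl p) i (widen_ord (leqnSn p) l) = X i l.
Proof. by rewrite mul_mx_incl /= (valK l). Qed.

Lemma mul_mx_incl_max p q (X : 'M[R]_(q, p)) i : (X *m incl p) i ord_max = 0.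
Proof. by rewrite mul_mx_incl insubF //= ltnn. Qed.

Lemma inclS p :
  incl p.+1 = (block_mx 1%:M 0 0 (incl p) : 'M[R]_(1 + p, 1 + p.+1)).
Proof.
rewrite -[LHS](@submxK _ 1 p 1 p.+1).
apply: (f_equal4 (@block_mx R 1 p 1 p.+1)); apply/matrixP => i j.
all: by rewrite !mxE //= !ord1.
Qed.

Lemma row_mx_incl p a (c : 'rV[R]_p) :
  (row_mx a%:M c : 'rV[R]_(p.+1)) *m incl p.+1 = row_mx a%:M (c *m incl p).
Proof.
(* The block sizes are given explicitly because [p.+2] and [1 + p.+1] agree only up to
   conversion. *)
rewrite inclS; apply: etrans (@mul_row_block _ 1 1 p 1 p.+1 _ _ _ _ _ _) _.
by rewrite mulmx1 !mulmx0 addr0 add0r.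
Qed.

(** A vector killed by the first map is zero outside its last block, and on such vectors
    [kronrow nx c] multiplies that block by the last entry of [c]. *)
Lemma kronI_incl_kernel nx p (c : 'rV[R]_p.+1) (v : 'cV[R]_(p.+1 * nx)) :
  c 0 ord_max != 0 -> kronI nx (incl p) *m v = 0 -> kronrow nx c *m v = 0 ->
  v = 0.
Proof.
move=> c0 /matrixP Iv0 /matrixP cv0.
have v_widen l s : v (mxtens_index (widen_ord (leqnSn p) l, s)) 0 = 0.
  have := Iv0 (mxtens_index (l, s)) 0; rewrite !mxE sum_mxtens.
  rewrite (bigD1 (widen_ord (leqnSn p) l)) //= [X in _ + X]big1 => [|k kl].
    rewrite addr0 (bigD1 s) //= big1 => [|t ts].
      by rewrite /kronI tensmxE !mxE !eqxx !mul1r addr0.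
    by rewrite /kronI tensmxE !mxE [s == t]eq_sym (negPf ts) mulr0 mul0r.
  rewrite big1 // => t _; rewrite /kronI tensmxE !mxE eq_sym.
  by rewrite (negPf kl : (val k == val l) = false) !mul0r.
apply/matrixP => k j; rewrite ord1 mxE; case: (mxtens_indexP k) => l s.
have := cv0 s 0; rewrite !mxE sum_mxtens big_ord_recr /=.
rewrite big1 => [|i _]; last by rewrite big1 // => t _; rewrite v_widen mulr0.
rewrite add0r (bigD1 s) //= big1 => [|t ts]; last first.
  by rewrite !mxE !mxtens_indexK /= eq_sym (negPf ts) mul0r.
rewrite !mxE !mxtens_indexK /= eqxx mulr1n addr0 => /eqP.
rewrite mulf_eq0 (negPf c0) /= => /eqP v_max.
have [lp|lp] := ltnP l p.
  by rewrite -[RHS](v_widen (Ordinal lp) s); congr (v (mxtens_index (_, _)) _);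
    apply: val_inj.
rewrite -[RHS]v_max; congr (v (mxtens_index (_, _)) _); apply: val_inj => /=.
by apply/eqP; rewrite eqn_leq lp -ltnS ltn_ord.
Qed.

End Inclusion.

(** * Legendre coordinates when M grows *)

Section Coordinates.
Variable R : realType.

(** The old expansion with a zero coefficient on the new polynomial is still an expansion, and
    coordinates are unique. *)
Lemma legendre_coordsS M (p : {poly R}) : (size p <= M)%N ->
  legendre_coords M.+1 p = legendre_coords M p *m incl R M.
Proof.
move=> szp; apply: legendre_coords_unique; rewrite big_ord_recr /=.
rewrite mul_mx_incl_max scale0r addr0 {1}(legendre_coordsP szp).
by apply: eq_bigr => l _; rewrite mul_mx_incl_widen.
Qed.

(** If the last coordinate vanished, the polynomial would be a combination of Legendre polynomials
    of degree below [M]. *)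
Lemma legendre_coords_max_neq0 M (p : {poly R}) : size p = M.+1 ->
  legendre_coords M.+1 p 0 ord_max != 0.
Proof.
move=> szp; apply/eqP => c0.
have : (size p <= M)%N; last by rewrite szp ltnn.
rewrite [p](@legendre_coordsP _ M.+1) ?szp // big_ord_recr /= c0 scale0r addr0.
apply: (leq_trans (size_sum _ _ _)); apply/bigmax_leqP => l _.
by rewrite (leq_trans (size_scale_leq _ _)) // size_jacobi0.
Qed.

Lemma xi_rowS M k i : (k + i < M)%N ->
  xi_row R M.+1 k i = xi_row R M k i *m incl R M.
Proof. by move=> kiM; apply: legendre_coordsS; rewrite size_qpoly. Qed.

(** Differentiation lowers the degree by one, so the index may go one further than in [xi_rowS]. *)
Lemma zeta_rowS M k i : (k + i <= M)%N ->
  zeta_row R M.+1 k i = zeta_row R M k i *m incl R M.+2.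
Proof.
move=> kiM; rewrite /zeta_row !row_mx_incl mulNmx -legendre_coordsS //.
by rewrite size_deriv size_qpoly.
Qed.

Lemma incl_L0mx M : incl R M *m L0mx R M.+1 = L0mx R M *m incl R M.+2.
Proof.
rewrite mul_incl_mx; apply/row_matrixP => i; rewrite row_mul !rowK.
rewrite -zeta_rowS ?(ltnW (ltn_ord i)) //.
by apply/rowP => j; rewrite !mxE.
Qed.

End Coordinates.

(** * The matrices of the inequalities as sums of congruences *)

Section Decomposition.
Variables (R : realType) (nx : nat).

Definition firstblock p : 'M[R]_(nx, p.+1 * nx) :=
  (row_mx 1%:M 0 : 'M[R]_(nx, nx + p * nx)).

Definition tailblocks p : 'M[R]_(p * nx, p.+1 * nx) :=
  (row_mx 0 1%:M : 'M[R]_(p * nx, nx + p * nx)).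

Definition xi_form M j (X : 'M[R]_nx) : 'M[R]_(M * nx) :=
  \sum_(i < (nu1 M j).+1)
    (j + 2 * i + 1)%:R *: congmx (kronrow nx (xi_row R M j i)) X.

(** The index [k] selects the rows and [j] the weights; the inequalities use it with [k] equal to
    [j.-1]. *)
Definition zeta_form M k j (X : 'M[R]_nx) : 'M[R]_(M.+2 * nx) :=
  \sum_(i < (nu2 M k).+1)
    (j + 2 * i)%:R *: congmx (kronrow nx (zeta_row R M k i)) X.

Lemma block_diag_congmx p (X : 'M[R]_nx) (Y : 'M[R]_(p * nx)) :
  (block_mx X 0 0 Y : 'M[R]_(nx + p * nx)) =
  congmx (firstblock p) X + congmx (tailblocks p) Y.
Proof.
rewrite /congmx /firstblock /tailblocks.
rewrite !tr_row_mx (mul_col_mx _ _ X) (mul_col_mx _ _ Y) !mul_col_row.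
rewrite !trmx0 !trmx1.
by rewrite !(mul0mx, mulmx0, mul1mx, mulmx1) add_block_mx !addr0 add0r.
Qed.

Lemma Ximx_congE M j (X : 'M[R]_nx) :
  (kronI nx (Ximx R M j))^T *m calQ M j X *m kronI nx (Ximx R M j) =
  xi_form M j X.
Proof.
by rewrite congmx_kronI_diag; apply: eq_bigr => i _; rewrite mxE rowK.
Qed.

Lemma Zmx_congE M j (X : 'M[R]_nx) :
  (kronI nx (Zmx R M j.-1))^T *m calR M j X *m kronI nx (Zmx R M j.-1) =
  zeta_form M j.-1 j X.
Proof.
by rewrite congmx_kronI_diag; apply: eq_bigr => i _; rewrite mxE rowK.
Qed.

Lemma Psi0E M m1 tau (P : 'M[R]_(M.+1 * nx)) Q :
  Psi0 m1 tau P Q =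
  tau *: P + congmx (tailblocks M) (\sum_(0 <= j < m1.+1) xi_form M j (Q j)).
Proof.
rewrite /Psi0 congmx_sum; congr (_ + _); apply: eq_bigr => j _.
by rewrite Ximx_congE block_diag_congmx /congmx mulmx0 mul0mx add0r.
Qed.

(** Products of selectors address the nested diagonal blocks: [firstblock M *m tailblocks M.+1]
    picks the second block, and two tails pick everything after it. *)
Lemma Psi2E M m1 (Q : nat -> 'M[R]_nx) :
  Psi2 M m1 Q =
  congmx (firstblock M.+1) (\sum_(0 <= j < m1.+1) Q j)
  - congmx (firstblock M *m tailblocks M.+1) (Q 0%N)
  - congmx (tailblocks M *m tailblocks M.+1)
      (\sum_(1 <= j < m1.+1) j%:R *: xi_form M j.-1 (Q j)).
Proof.
rewrite /Psi2 (@block_diag_congmx M) (@block_diag_congmx M.+1).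
rewrite congmxD !congmxN !congmxM addrA; congr (_ - congmx _ (congmx _ _)).
by apply: eq_bigr => j _; rewrite Ximx_congE.
Qed.

Lemma Psi32E M m2 tau (Rm : nat -> 'M[R]_nx) :
  Psi32 M m2 tau Rm =
  tau^-1 *: \sum_(1 <= j < m2.+1) j%:R *: zeta_form M j.-1 j (Rm j).
Proof.
by congr (_ *: _); apply: eq_bigr => j _; rewrite Zmx_congE.
Qed.

Lemma psdmx_xi_form M j (X : 'M[R]_nx) : psdmx X -> psdmx (xi_form M j X).
Proof.
move=> pX; apply: psdmx_sum => i _; apply: psdmxZ; first exact: ler0n.
exact: psdmx_congmx.
Qed.

Lemma psdmx_zeta_form M k j (X : 'M[R]_nx) :
  psdmx X -> psdmx (zeta_form M k j X).
Proof.
move=> pX; apply: psdmx_sum => i _; apply: psdmxZ; first exact: ler0n.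
exact: psdmx_congmx.
Qed.

End Decomposition.

(** * The matrices of the inequalities under the passage from M to M+1 *)

Section IncreaseM.
Variables (R : realType) (nx : nat).
Implicit Types X : 'M[R]_nx.

Local Notation emb p := (kronI nx (incl R p)).

Lemma kronI_inclS p :
  emb p.+1 = (block_mx 1%:M 0 0 (emb p) : 'M[R]_(nx + p * nx, nx + p.+1 * nx)).
Proof. by rewrite inclS kronI_block_mx. Qed.

Lemma firstblock_emb p : firstblock R nx p *m emb p.+1 = firstblock R nx p.+1.
Proof.
rewrite kronI_inclS /firstblock.
apply: etrans (@mul_row_block _ nx nx (p * nx) nx (p.+1 * nx) _ _ _ _ _ _) _.
by rewrite mulmx1 !(mulmx0, mul0mx) !addr0.
Qed.

Lemma tailblocks_emb p :
  tailblocks R nx p *m emb p.+1 = emb p *m tailblocks R nx p.+1.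
Proof.
rewrite kronI_inclS /tailblocks.
apply: etrans (@mul_row_block _ (p * nx) nx (p * nx) nx (p.+1 * nx)
  _ _ _ _ _ _) _.
rewrite !(mulmx0, mul0mx) !add0r.
by rewrite mul_mx_row mul1mx mulmx0 mulmx1.
Qed.

(** This is the contribution of the one row that [Ximx] gains, at index [nu1 M.+1 j]; [zeta_extra]
    plays the same role for [Zmx]. *)
Definition xi_extra M j X : 'M[R]_(M.+1 * nx) :=
  (j + 2 * (M - j) + 1)%:R *:
    congmx (kronrow nx (xi_row R M.+1 j (M - j))) X.

Definition zeta_extra M k j X : 'M[R]_(M.+3 * nx) :=
  (j + 2 * (M.+1 - k))%:R *:
    congmx (kronrow nx (zeta_row R M.+1 k (M.+1 - k))) X.

Lemma psdmx_xi_extra M j X : psdmx X -> psdmx (xi_extra M j X).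
Proof. by move=> pX; apply/psdmxZ/psdmx_congmx. Qed.

Lemma psdmx_zeta_extra M k j X : psdmx X -> psdmx (zeta_extra M k j X).
Proof. by move=> pX; apply/psdmxZ/psdmx_congmx. Qed.

Lemma xi_formS M j X : (j < M)%N ->
  xi_form M.+1 j X = congmx (emb M) (xi_form M j X) + xi_extra M j X.
Proof.
move=> jM; rewrite /xi_form congmx_sum.
have -> : nu1 M.+1 j = (M - j)%N by rewrite /nu1; lia.
(* The subtraction in [nu1] is truncated, so [j < M] is what makes the row count grow by exactly
   one. *)
have -> : (nu1 M j).+1 = (M - j)%N by rewrite /nu1; lia.
rewrite big_ord_recr /=; congr (_ + _); apply: eq_bigr => i _.
rewrite congmxZ -congmxM -kronrowM -xi_rowS //.
by have := ltn_ord i; lia.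
Qed.

Lemma zeta_formS M k j X : (k <= M)%N ->
  zeta_form M.+1 k j X =
  congmx (emb M.+2) (zeta_form M k j X) + zeta_extra M k j X.
Proof.
move=> kM; rewrite /zeta_form congmx_sum.
have -> : nu2 M.+1 k = (M.+1 - k)%N by [].
have -> : (nu2 M k).+1 = (M.+1 - k)%N by rewrite /nu2; lia.
rewrite big_ord_recr /=; congr (_ + _); apply: eq_bigr => i _.
rewrite congmxZ -congmxM -kronrowM -zeta_rowS //.
by have := ltn_ord i; lia.
Qed.

Lemma calA_emb (A Ad1 Ad2 : 'M[R]_nx) M tau : (1 <= M)%N ->
  calA A Ad1 Ad2 M.+1 tau = calA A Ad1 Ad2 M tau *m emb M.+2.
Proof.
move=> M1; rewrite /calA mul_blockrow_kronI; apply: eq_blockrow => l.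
have [lM|lM] := ltnP l M.+2.
  rewrite (bigD1 (Ordinal lM)) //= mxE eqxx scale1r big1 ?addr0 // => k kl.
  by rewrite mxE (negPf kl : (k == l :> nat) = false) scale0r.
(* As [M] is at least 1, the three nonzero blocks already fit among the first [M.+2], and the
   appended block is zero. *)
rewrite nth_default; last exact: leq_trans lM.
rewrite big1 // => k _; rewrite mxE ltn_eqF ?scale0r //.
exact: leq_trans lM.
Qed.

Lemma emb_Lambda (A Ad1 Ad2 : 'M[R]_nx) M tau : (1 <= M)%N ->
  emb M.+1 *m Lambda A Ad1 Ad2 M.+1 tau = Lambda A Ad1 Ad2 M tau *m emb M.+2.
Proof.
move=> M1; rewrite kronI_inclS.
apply: etrans (@mul_block_col _ nx (M * nx) nx (M.+1 * nx) _ _ _ _ _ _ _) _.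
rewrite mul1mx !mul0mx addr0 add0r /Lambda (mul_col_mx (calA _ _ _ _ _)).
by rewrite calA_emb // !kronI_mul incl_L0mx.
Qed.

Lemma emb_Gamma M (tau : R) :
  emb M.+1 *m Gamma nx M.+1 tau = Gamma nx M tau *m emb M.+2.
Proof.
rewrite /Gamma !kronI_mul; congr kronI.
rewrite (inclS _ M) (inclS _ M.+1) (inclS _ M).
apply: etrans (@mulmx_block _ 1 M 1 M.+1 1 M.+2 _ _ _ _ _ _ _ _) _.
apply: esym.
apply: etrans (@mulmx_block _ 1 M 1 M.+1 1 M.+2 _ _ _ _ _ _ _ _) _.
rewrite !(mul1mx, mulmx1, mul0mx, mulmx0, addr0, add0r).
apply: (f_equal4 (@block_mx R 1 M 1 M.+2)) => //.
  by rewrite row_mx0 mul0mx row_mx0.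
apply: etrans (@mul_row_block _ M 1 M 1 M.+1 _ _ _ _ _ _) _.
apply: esym; apply: etrans (@mul_mx_row _ M M.+1 1 M.+1 _ _ _) _.
by rewrite !(mul0mx, mulmx0, addr0, add0r) scalar_mxC.
Qed.

Lemma Psi0_incM M m tau (P : 'M[R]_(M.+1 * nx)) Q : (m < M)%N ->
  Psi0 m tau (congmx (emb M.+1) P) Q =
  congmx (emb M.+1) (Psi0 m tau P Q) +
  congmx (tailblocks R nx M.+1) (\sum_(0 <= j < m.+1) xi_extra M j (Q j)).
Proof.
move=> mM; rewrite !Psi0E congmxD congmxZ -!addrA; congr (_ + _).
rewrite -congmxM tailblocks_emb congmxM -congmxD; congr congmx.
rewrite congmx_sum -big_split /=; apply: eq_big_nat => j /andP[_ jm].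
by rewrite xi_formS // (leq_trans jm).
Qed.

(** [Lambda] and [Gamma] intertwine the two embeddings, so this term transforms by a pure
    congruence, without a remainder. *)
Lemma Psi1_incM (A Ad1 Ad2 : 'M[R]_nx) M tau (P : 'M[R]_(M.+1 * nx)) :
  (1 <= M)%N ->
  Psi1 A Ad1 Ad2 tau (congmx (emb M.+1) P) =
  congmx (emb M.+2) (Psi1 A Ad1 Ad2 tau P).
Proof.
move=> M1; rewrite congmxD /Psi1 /congmx.
have EG := emb_Gamma M tau; have EL := emb_Lambda A Ad1 Ad2 tau M1.
have EGt := congr1 trmx EG; have ELt := congr1 trmx EL.
rewrite !trmx_mul in EGt ELt.
by rewrite !mulmxA EGt ELt -!mulmxA EG EL.
Qed.

(** Only the third diagonal block gains rows. They enter with a minus sign, which is the favourable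
    one for negative definiteness. *)
Lemma Psi2_incM M m (Q : nat -> 'M[R]_nx) : (m <= M)%N ->
  Psi2 M.+1 m Q = congmx (emb M.+2) (Psi2 M m Q) -
    congmx (tailblocks R nx M.+1 *m tailblocks R nx M.+2)
      (\sum_(1 <= j < m.+1) j%:R *: xi_extra M j.-1 (Q j)).
Proof.
move=> mM; rewrite !Psi2E !congmxD !congmxN -!congmxM.
have -> : firstblock R nx M *m tailblocks R nx M.+1 *m emb M.+2 =
          firstblock R nx M.+1 *m tailblocks R nx M.+2.
  by rewrite -mulmxA tailblocks_emb mulmxA firstblock_emb.
have -> : tailblocks R nx M *m tailblocks R nx M.+1 *m emb M.+2 =
          emb M *m (tailblocks R nx M.+1 *m tailblocks R nx M.+2).
  by rewrite -mulmxA tailblocks_emb mulmxA tailblocks_emb -mulmxA.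
rewrite firstblock_emb -[_ - _ - _ in RHS]addrA; congr (_ + _).
rewrite -opprD; congr (- _); rewrite (congmxM (emb M)) -congmxD; congr congmx.
rewrite congmx_sum -big_split; apply: eq_big_nat => j /andP[j1 jm] /=.
rewrite congmxZ -scalerDr -xi_formS //; lia.
Qed.

Lemma Psi31_incM (A Ad1 Ad2 : 'M[R]_nx) M m2 tau (Rm : nat -> 'M[R]_nx) :
  (1 <= M)%N ->
  Psi31 A Ad1 Ad2 M.+1 m2 tau Rm =
  congmx (emb M.+2) (Psi31 A Ad1 Ad2 M m2 tau Rm).
Proof.
by move=> M1;
  rewrite /Psi31 congmxZ -[_ *m _ *m _]/(congmx _ _) calA_emb // congmxM.
Qed.

Lemma Psi32_incM M m2 tau (Rm : nat -> 'M[R]_nx) : (m2 <= M.+1)%N ->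
  Psi32 M.+1 m2 tau Rm = congmx (emb M.+2) (Psi32 M m2 tau Rm) +
    tau^-1 *: \sum_(1 <= j < m2.+1) j%:R *: zeta_extra M j.-1 j (Rm j).
Proof.
move=> mM; rewrite !Psi32E congmxZ -scalerDr; congr (_ *: _).
rewrite congmx_sum -big_split; apply: eq_big_nat => j /andP[j1 jm] /=.
rewrite congmxZ -scalerDr -zeta_formS //; lia.
Qed.

End IncreaseM.

(** * Transfer of feasible solutions *)

Section Feasibility.
Variables (R : realType) (nx : nat) (A Ad1 Ad2 : 'M[R]_nx).

Lemma zeta_row_max_neq0 M : zeta_row R M.+1 0 M.+1 0 ord_max != 0.
Proof.
have -> : ord_max = rshift 1 (rshift 1 ord_max) :> 'I_(1 + (1 + M.+1)).
  exact: val_inj.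
rewrite /zeta_row !row_mxEr mxE oppr_eq0 legendre_coords_max_neq0 //.
by rewrite size_deriv size_qpoly.
Qed.

(** The sum in [Psi0] does not see the first block, so its rows get a leading zero before
    [kronI_incl_kernel] can be applied to the full vector. *)
Lemma row_mx_xi_row_max_neq0 M :
  (row_mx 0%:M (xi_row R M.+1 0 M) : 'rV_(1 + M.+1)) 0 ord_max != 0.
Proof.
have -> : ord_max = rshift 1 ord_max :> 'I_(1 + M.+1) by apply: val_inj.
by rewrite row_mxEr legendre_coords_max_neq0 // size_qpoly.
Qed.

Lemma kronrow_tailblocks p (c : 'rV[R]_p) :
  kronrow nx c *m tailblocks R nx p = kronrow nx (row_mx 0%:M c : 'rV_(1 + p)).
Proof.
by rewrite kronrow_row_mx /tailblocks mul_mx_row mulmx0 mulmx1 raddf0.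
Qed.

Lemma LMI_feasible_incM M m tau : (1 <= M)%N -> (m < M)%N -> 0 < tau ->
  LMI_feasible A Ad1 Ad2 M m tau -> LMI_feasible A Ad1 Ad2 M.+1 m tau.
Proof.
move=> M1 mM tau0 [P [Q [Rm [/symmetricmxP sP pQ pR p0 /negdefmxN nN]]]].
exists (congmx (kronI nx (incl R M.+1)) P), Q, Rm; split=> //.
- by apply/symmetricmxP; rewrite trmx_congmx.
- have pX j : (j <= m)%N -> psdmx (xi_extra M j (Q j)).
    by move=> jm; apply/psdmx_xi_extra/posdefmx_psd/pQ.
  rewrite Psi0_incM //; apply: posdefmx_congD => // [|v Fv0 v0].
    apply/psdmx_congmx/psdmx_sum => j; rewrite mem_index_iota ltnS.
    move=> /andP[_ jm].
    exact: pX.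
  (* On the kernel the term [j = 0] is strictly positive, and the remaining terms only need to be
     nonnegative. *)
  rewrite qform_congmx big_nat_recl // qformD ltr_pwDl //; last first.
    have [|_] // := @psdmx_sum _ _ _ (index_iota 0 m)
      (fun j => xi_extra M j.+1 (Q j.+1)).
    by move=> j; rewrite mem_index_iota => /andP[_ jm]; apply: pX.
  rewrite /xi_extra subn0 qformZ qform_congmx mulmxA mulr_gt0 ?ltr0n ?addn1 //.
  have [_] := pQ 0%N isT; apply; apply: contra_neq v0.
  rewrite kronrow_tailblocks; apply: kronI_incl_kernel Fv0.
  exact: row_mx_xi_row_max_neq0.
rewrite Psi1_incM // Psi2_incM ?(ltnW mM) // Psi31_incM //.
rewrite Psi32_incM ?ltnS ?(ltnW mM) //.
apply/negdefmxN; set T := kronI nx (incl R M.+2).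
(* [Y2] and [Y3] collect the additional rows of [Psi2] and [Psi32]. Negating the second inequality
   turns both into positive semidefinite summands. *)
set Y2 := congmx (_ *m _) _; set Y3 := _^-1 *: _.
set N := (_ - _) in nN.
have -> : - (congmx T (Psi1 A Ad1 Ad2 tau P) + (congmx T (Psi2 M m Q) - Y2)
    + congmx T (Psi31 A Ad1 Ad2 M m.+1 tau Rm)
    - (congmx T (Psi32 M m.+1 tau Rm) + Y3)) = congmx T (- N) + (Y2 + Y3).
  rewrite /N congmxN !congmxD congmxN.
  by apply/matrixP => i j; rewrite !mxE; ring.
have pX j : (1 <= j <= m.+1)%N -> psdmx (zeta_extra M j.-1 j (Rm j)).
  by move=> jm; apply/psdmx_zeta_extra/posdefmx_psd/pR.
have pY2 : psdmx Y2.
  apply/psdmx_congmx/psdmx_sum => j; rewrite mem_index_iota => /andP[_ jm].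
  by apply/psdmxZ/psdmx_xi_extra/posdefmx_psd/pQ.
have pY3 : psdmx Y3.
  apply: psdmxZ; first by rewrite invr_ge0 ltW.
  apply: psdmx_sum => j; rewrite mem_index_iota => jm.
  by apply: psdmxZ => //; apply: pX.
apply: posdefmx_congD => // [|v Tv0 v0]; first exact: psdmxD.
rewrite qformD ltr_wpDl //; first by case: pY2.
(* Strictness comes from [j = 1], where the additional row belongs to [k = 0] and ends in a nonzero
   coordinate of the derivative of [qpoly R 0 M.+1]. *)
rewrite /Y3 qformZ mulr_gt0 ?invr_gt0 // big_nat_recl // qformD ltr_pwDl //.
  rewrite scale1r /zeta_extra subn0 qformZ qform_congmx mulr_gt0 ?ltr0n //.
  have [_] := pR 1%N isT; apply; apply: contra_neq v0.
  exact: kronI_incl_kernel (zeta_row_max_neq0 M) Tv0.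
have [|_] // := @psdmx_sum _ _ _ (index_iota 1 m.+1)
  (fun j => j.+1%:R *: zeta_extra M j.+1.-1 j.+1 (Rm j.+1)).
move=> j; rewrite mem_index_iota => /andP[_ jm].
by apply: psdmxZ => //; apply: pX.
Qed.

Lemma posdefmx_scalar n (a : R) : 0 < a -> posdefmx (a%:M : 'M_n).
Proof.
move=> a0; split=> [|v v0]; first by apply/symmetricmxP; rewrite tr_scalar_mx.
rewrite mul_mx_scalar -scalemxAl mxE mulr_gt0 // mxE.
have sq_ge0 i : 0 <= v^T 0 i * v i 0 by rewrite mxE -expr2 sqr_ge0.
rewrite lt0r sumr_ge0 // andbT; apply: contra_neq v0 => /psumr_eq0P sq0.
apply/colP => i; rewrite mxE; apply/eqP; rewrite -sqrf_eq0 expr2.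
by rewrite -{1}[v]trmxK mxE sq0.
Qed.

Lemma LMI_feasible_incm M m tau : 0 < tau ->
  LMI_feasible A Ad1 Ad2 M m tau -> LMI_feasible A Ad1 Ad2 M m.+1 tau.
Proof.
move=> tau0 [P [Q [Rm [sP pQ pR p0 /negdefmxN]]]].
set N := (_ - _) => nN.
have [c1 c1_ge0 c1P] := posdefmx_dominates (firstblock R nx M.+1) nN.
have [c2 c2_ge0 c2P] := posdefmx_dominates (calA A Ad1 Ad2 M tau) nN.
(* This choice gives [e * (c1 + tau * c2) < 1]; the summand 1 makes the inequality strict and the
   denominator positive. *)
pose e := (1 + c1 + tau * c2)^-1.
have d0 : 0 < 1 + c1 + tau * c2.
  by rewrite -addrA ltr_pwDl // addr_ge0 // mulr_ge0 // ltW.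
have e0 : 0 < e by rewrite invr_gt0.
have pe : posdefmx (e%:M : 'M_nx) by apply: posdefmx_scalar.
pose Q' j := if (j <= m)%N then Q j else e%:M.
pose Rm' j := if (j <= m.+1)%N then Rm j else e%:M.
have Q'E j : (j < m.+1)%N -> Q' j = Q j by rewrite ltnS /Q' => ->.
have Rm'E j : (j < m.+2)%N -> Rm' j = Rm j by rewrite ltnS /Rm' => ->.
have Q'S : Q' m.+1 = e%:M by rewrite /Q' ltnn.
have Rm'S : Rm' m.+2 = e%:M by rewrite /Rm' ltnn.
exists P, Q', Rm'; split=> //.
- by rewrite /Q' => j jm; case: ifP => // ?; apply: pQ.
- move=> j /andP[j1 jm]; rewrite /Rm'; case: ifP => // ?; apply: pR.
  by rewrite j1.
- have -> : Psi0 m.+1 tau P Q' =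
      Psi0 m tau P Q + congmx (tailblocks R nx M) (xi_form M m.+1 e%:M).
    rewrite !Psi0E big_nat_recr //= congmxD Q'S addrA.
    congr (_ + congmx _ _ + _).
    by apply: eq_big_nat => j /andP[_ jm]; rewrite Q'E.
  apply: posdefmxD => //; apply/psdmx_congmx/psdmx_xi_form.
  exact: posdefmx_psd.
apply/negdefmxN.
(* [e *: G] is the whole unfavourable contribution of the new matrices: the new Q in the leading
   block of [Psi2] and the new R in [Psi31]. Their remaining contributions, [Y2] and [Y3], are
   positive semidefinite after negation. *)
pose G := (firstblock R nx M.+1)^T *m firstblock R nx M.+1 +
  tau *: ((calA A Ad1 Ad2 M tau)^T *m calA A Ad1 Ad2 M tau).
pose Y2 := congmx (tailblocks R nx M *m tailblocks R nx M.+1)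
  (m.+1%:R *: xi_form M m e%:M).
pose Y3 := tau^-1 *: (m.+2%:R *: zeta_form M m.+1 m.+2 (e%:M : 'M_nx)).
have congmx_scalar p (B : 'M[R]_(nx, p)) : congmx B e%:M = e *: (B^T *m B).
  by rewrite /congmx mul_mx_scalar -scalemxAl.
have EPsi2 : Psi2 M m.+1 Q' =
    Psi2 M m Q + e *: ((firstblock R nx M.+1)^T *m firstblock R nx M.+1) - Y2.
  rewrite !Psi2E big_nat_recr //.
  rewrite [X in congmx (tailblocks _ _ _ *m _) X]big_nat_recr //=.
  rewrite Q'S congmxD congmx_scalar (Q'E 0%N) //.
  rewrite (congmxD (tailblocks _ _ _ *m _)).
  rewrite (eq_big_nat _ _ (fun j jm => Q'E j (proj2 (andP jm)))).
  rewrite -/Y2 [in LHS](eq_big_nat _ _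
    (F2 := fun j => j%:R *: xi_form M j.-1 (Q j))).
    move: (congmx _ _) (e *: _) (congmx _ _) (congmx _ _) (Y2).
    move=> B1 B2 B3 B4 B5.
    by apply/matrixP => i j; rewrite !mxE; ring.
  by move=> j /andP[_ jm]; rewrite Q'E.
have EPsi31 : Psi31 A Ad1 Ad2 M m.+2 tau Rm' =
    Psi31 A Ad1 Ad2 M m.+1 tau Rm +
    e *: (tau *: ((calA A Ad1 Ad2 M tau)^T *m calA A Ad1 Ad2 M tau)).
  rewrite /Psi31 -!/(congmx _ _) big_nat_recr //= Rm'S congmxD congmx_scalar.
  rewrite scalerDr !scalerA [tau * e]mulrC; congr (_ *: congmx _ _ + _).
  by apply: eq_big_nat => j /andP[_ jm]; rewrite Rm'E.
have EPsi32 : Psi32 M m.+2 tau Rm' = Psi32 M m.+1 tau Rm + Y3.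
  rewrite !Psi32E big_nat_recr //= Rm'S scalerDr; congr (_ *: _ + _).
  by apply: eq_big_nat => j /andP[_ jm]; rewrite Rm'E.
have -> : - (Psi1 A Ad1 Ad2 tau P + Psi2 M m.+1 Q'
    + Psi31 A Ad1 Ad2 M m.+2 tau Rm' - Psi32 M m.+2 tau Rm') =
    (- N - e *: G) + (Y2 + Y3).
  rewrite EPsi2 EPsi31 EPsi32 /N /G scalerDr.
  move: (Psi1 _ _ _ _ _) (Psi2 _ _ _) (Psi31 _ _ _ _ _ _ _) (Psi32 _ _ _ _).
  move: (e *: _) (e *: _) (Y2) (Y3) => B1 B2 B3 B4 X1 X2 X3 X4.
  by apply/matrixP => i j; rewrite !mxE; ring.
apply: posdefmxD; last first.
  have pxi := psdmx_xi_form M m (posdefmx_psd pe).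
  have pzeta := psdmx_zeta_form M m.+1 m.+2 (posdefmx_psd pe).
  apply: psdmxD; first by apply/psdmx_congmx/psdmxZ.
  by apply: psdmxZ; [rewrite invr_ge0 ltW | apply: psdmxZ].
split=> [|v v0].
  apply/symmetricmxP; have [/symmetricmxP sN _] := nN.
  have sG : G^T = G.
    by rewrite /G linearD linearZ /= !trmx_mul !trmxK.
  apply: etrans (linearD _ _ _) _; congr (_ + _); first exact: sN.
  by rewrite linearN linearZ /= sG.
rewrite -/(qform _ _) qformD (qformN (e *: G)) qformZ subr_gt0.
have N0 : 0 < qform (- N) v by case: nN => _; apply.
(* After clearing the denominator the claim is the sum of the two domination bounds, the second
   scaled by [tau], made strict by [N0]. *)
rewrite /e mulrC ltr_pdivrMr // /G qformD qformZ.
have := c1P v; have := ler_wpM2l (ltW tau0) (c2P v).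
by nra.
Qed.

End Feasibility.

Theorem theorem2 (R : realType) (nx : nat) (A Ad1 Ad2 : 'M[R]_nx)
    (M m : nat) (hnx : (1 <= nx)%N) (hM : (1 <= M)%N) (hm : (m <= M - 1)%N) :
  LMI_prec A Ad1 Ad2 M m (M + 1) m /\
  ((m + 1 <= M - 1)%N -> LMI_prec A Ad1 Ad2 M m M (m + 1)).
Proof.
rewrite !addn1; split=> [|_] tau tau0.
  by apply: LMI_feasible_incM => //; lia.
exact: LMI_feasible_incm.
Qed.
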